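(* Let $\tau\geq 2$ be an integer and let $G$ be a connected graph of order $n \geq 4\tau^2+5\tau+1$. If $\lambda_1(D(G)) \leq \lambda_1\big(D(K_{\tau-1} \vee (K_{n-\tau} \cup K_1))\big)$, then $G$ is a $\tau$-tough graph, unless $G \cong K_{\tau-1} \vee (K_{n-\tau} \cup K_1)$.
   Context: All graphs are finite and simple. For a connected graph $G$ with vertex set $\{v_1,\dots,v_n\}$, the distance matrix $D(G)$ is the $n\times n$ matrix whose $(i,j)$-entry is the length of a shortest path between $v_i$ and $v_j$; $\lambda_1(D(G))$ denotes its largest eigenvalue (the distance spectral radius). For a graph $G$ and $S\subseteq V(G)$, $G-S$ is the subgraph induced by $V(G)\setminus S$ and $c(G-S)$ is its number of connected components. For a connected non-complete graph $G$, $\tau(G)=\min\left\{\frac{|S|}{c(G-S)-1} : S\subset V(G),\ c(G-S)>1\right\}$; $G$ is called $\tau$-tough if $\tau(G)\geq \tau$ (a graph admitting no $S$ with $c(G-S)>1$, e.g. a complete graph, is regarded as $\tau$-tough). $K_m$ is the complete graph on $m$ vertices, $G_1\cup G_2$ is the disjoint union, and $G_1\vee G_2$ (the join) is obtained from $G_1\cup G_2$ by adding all edges between $V(G_1)$ and $V(G_2)$. *)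

(* Defs.v *)
From HB Require Import structures.
From mathcomp Require Import all_boot all_order all_algebra.
From mathcomp Require Import classical_sets reals.
Set Implicit Arguments.
Unset Strict Implicit.
Unset Printing Implicit Defensive.
Import Order.TTheory GRing.Theory Num.Theory.
Local Open Scope ring_scope.

Record sgraph := SGraph {
  svertex :> finType;
  sedge : rel svertex;
  sedge_sym : symmetric sedge;
  sedge_irr : irreflexive sedge }.

Definition connected_graph (G : sgraph) : Prop :=
  (0 < #|G|)%N /\ forall x y : G, connect (@sedge G) x y.

Definition graph_iso (G H : sgraph) : Prop :=
  exists2 f : G -> H, bijective f & forall x y, sedge (f x) (f y) = sedge x y.

Section Complete.
Variable m : nat.
Definition complete_edge : rel 'I_m := fun x y => x != y.
Lemma complete_edge_sym : symmetric complete_edge.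
Proof. by move=> x y; rewrite /complete_edge eq_sym. Qed.
Lemma complete_edge_irr : irreflexive complete_edge.
Proof. by move=> x; rewrite /complete_edge eqxx. Qed.
Definition complete_graph := SGraph complete_edge_sym complete_edge_irr.
End Complete.

Section UnionJoin.
Variables G1 G2 : sgraph.

Definition union_edge : rel (G1 + G2)%type := fun u v =>
  match u, v with
  | inl x, inl y => sedge x y
  | inr x, inr y => sedge x y
  | _, _ => false
  end.
Lemma union_edge_sym : symmetric union_edge.
Proof. by move=> [x|x] [y|y] //=; rewrite sedge_sym. Qed.
Lemma union_edge_irr : irreflexive union_edge.
Proof. by move=> [x|x] /=; rewrite sedge_irr. Qed.
Definition graph_union := SGraph union_edge_sym union_edge_irr.

Definition join_edge : rel (G1 + G2)%type := fun u v =>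
  match u, v with
  | inl x, inl y => sedge x y
  | inr x, inr y => sedge x y
  | _, _ => true
  end.
Lemma join_edge_sym : symmetric join_edge.
Proof. by move=> [x|x] [y|y] //=; rewrite sedge_sym. Qed.
Lemma join_edge_irr : irreflexive join_edge.
Proof. by move=> [x|x] /=; rewrite sedge_irr. Qed.
Definition graph_join := SGraph join_edge_sym join_edge_irr.
End UnionJoin.

Section Induced.
Variables (G : sgraph) (A : {set G}).
Definition induced_edge : rel {x : G | x \in A} :=
  fun x y => sedge (val x) (val y).
Lemma induced_edge_sym : symmetric induced_edge.
Proof. by move=> x y; rewrite /induced_edge sedge_sym. Qed.
Lemma induced_edge_irr : irreflexive induced_edge.
Proof. by move=> x; rewrite /induced_edge sedge_irr. Qed.
Definition induced_graph := SGraph induced_edge_sym induced_edge_irr.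
End Induced.

Definition num_components (G : sgraph) : nat := n_comp (@sedge G) predT.

(* c(G - S) *)
Definition comp_minus (G : sgraph) (S : {set G}) : nat :=
  num_components (induced_graph (~: S)).

Definition has_path_of_length (G : sgraph) (x y : G) (k : nat) : bool :=
  [exists p : k.-tuple G,
     [&& path (@sedge G) x p, last x p == y & uniq (x :: p)]].

(* A path has fewer than #|G| edges, so this [find] is the least k admitting an
   x-y path of length k; it takes the junk value #|G| when there is no path. *)
Definition gdist (G : sgraph) (x y : G) : nat :=
  find (has_path_of_length x y) (iota 0 #|G|).

Definition distance_matrix (R : realType) (G : sgraph) : 'M[R]_#|G| :=
  \matrix_(i, j) (gdist (enum_val i) (enum_val j))%:R.

(* The junk value 0 is never taken on a nonempty real symmetric matrix, the
   only case of interest; such a matrix has a (finite, nonempty) real spectrum. *)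
Definition largest_eigenvalue (R : realType) (n : nat) (A : 'M[R]_n) : R :=
  xget 0 [set a : R | eigenvalue A a
                      /\ (forall b : R, eigenvalue A b -> b <= a)]%classic.

Definition is_cut (G : sgraph) (S : {set G}) : bool := (1 < comp_minus S)%N.

Definition cut_ratio (G : sgraph) (S : {set G}) : rat :=
  #|S|%:R / ((comp_minus S).-1)%:R.

(* None when no S satisfies c(G - S) > 1, e.g. for complete graphs. *)
Definition toughness (G : sgraph) : option rat :=
  if [pick S : {set G} | is_cut S] is Some S0
  then Some (cut_ratio [arg min_(S < S0 | is_cut S) cut_ratio S]%O)
  else None.

Definition is_tough (t : rat) (G : sgraph) : bool :=
  if toughness G is Some r then t <= r else true.

Definition extremal_graph (t n : nat) : sgraph :=
  graph_join (complete_graph (t - 1))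
             (graph_union (complete_graph (n - t)) (complete_graph 1)).

(* Main.v *)
(* A graph that is not t-tough has a set S of s < tk vertices whose removal leaves
   k + 1 >= 2 components.  The graph K_{t-1} v (K_{n-t} u K_1) has an explicit
   positive distance eigenvector, constant on the three parts, whose eigenvalue is
   mu - 1 for a root mu < n + 3 of a cubic; hence its distance spectral radius is
   mu - 1 < n + 2.

   If some vertex of G has degree less than t, then after relabelling D(G)
   dominates the extremal distance matrix entrywise, and the Rayleigh quotient of
   D(G) at that eigenvector exceeds mu - 1 unless the two matrices coincide.
   Otherwise G has at least 3n ordered pairs of distinct non-adjacent vertices,
   and the Rayleigh quotient of D(G) at the all-ones vector is at least n + 2.  The
   bound n >= 4t^2 + 5t + 1 is what makes the pair count work for every k. *)
Require Import Defs.
From mathcomp Require Import all_boot all_order all_algebra.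
From mathcomp Require Import reals spectral sesquilinear.
From mathcomp Require Import complex polyrcf ring lra zify.
From mathcomp Require classical_sets.
Set Implicit Arguments.
Unset Strict Implicit.
Unset Printing Implicit Defensive.
Import Order.TTheory GRing.Theory Num.Theory.
Local Open Scope ring_scope.

(** * Rayleigh quotients and Perron vectors *)

(** The spectral theorem is applied over the complex numbers, where [A] becomes Hermitian. Its
    spectrum is real, and the largest diagonal entry of the diagonalisation is the required [a]. *)
Lemma symmetric_max_eigenvalue (R : rcfType) (n : nat) (A : 'M[R]_n) :
  (0 < n)%N -> A^T = A ->
  exists2 a, eigenvalue A a &
    forall x : 'rV[R]_n, (x *m A *m x^T) 0 0 <= a * (x *m x^T) 0 0.
Proof.
move=> n_gt0 symA.
pose toC := real_complex R; pose B := map_mx toC A.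
have B_real : B \is a realmx.
  by apply/mxOverP => i j; rewrite mxE; apply/complex_realP; exists (A i j).
have B_herm : B \is hermsymmx.
  apply: realsym_hermsym => //; apply/is_hermitianmxP.
  by rewrite expr0 scale1r; apply/matrixP => i j; rewrite !mxE -[in LHS]symA mxE.
have BE := orthomx_spectralP (hermitian_normalmx B_herm).
have P_unitary := spectral_unitarymx B; have P_unit := spectral_unit B.
have sp_real := hermitian_spectral_diag_real B_herm.
set P := spectralmx B in BE P_unitary P_unit.
set sp := spectral_diag B in BE sp_real.
have spE i : sp 0 i = toC (complex.Re (sp 0 i)).
  by have /mxOverP/(_ 0 i)/complex_realP[r ->] := sp_real.
have [i0 _ i0_max] :=
  @arg_maxP _ _ 'I_n (Ordinal n_gt0) xpredT (fun i => complex.Re (sp 0 i)) isT.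
exists (complex.Re (sp 0 i0)) => [|x].
  suff: eigenvalue B (sp 0 i0) by rewrite spE eigenvalue_map.
  apply/eigenvalueP; exists (row i0 P).
    rewrite -row_mul BE !mulmxA mulmxV // mul1mx.
    by apply/rowP => j; rewrite !mxE (bigD1 i0) //= !mxE eqxx big1 ?addr0 //
      => k /negPf nk; rewrite !mxE eq_sym nk mul0r.
  apply/negP => /eqP row0; have : row_free P by rewrite row_free_unit.
  move/row_freeP => [Q /(congr1 (row i0))].
  rewrite row_mul row0 mul0mx => /rowP/(_ i0)/eqP.
  by rewrite !mxE eqxx eq_sym oner_eq0.
(* [y] holds the coordinates of [x] in the orthonormal eigenbasis formed by the rows of [P]. In them
   the quadratic form becomes a sum of squared moduli weighted by the spectrum. *)
pose z := map_mx toC x; pose y := z *m invmx P.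
have z_conj : (z ^t Num.conj)%sesqui = z^T.
  by apply/matrixP => i j; rewrite !mxE conj_Creal //; apply/complex_realP; eexists.
have yE : P *m z^T = (y ^t Num.conj)%sesqui.
  by rewrite /y (invmx_unitary P_unitary) trmx_mul map_mxM z_conj trmxCK.
have yC i : (y ^t Num.conj)%sesqui i 0 = (y 0 i)^* by rewrite !mxE.
have quadE : toC ((x *m A *m x^T) 0 0) = \sum_i sp 0 i * (y 0 i * (y 0 i)^*).
  have -> : toC ((x *m A *m x^T) 0 0) = (z *m B *m z^T) 0 0.
    by rewrite /z /B map_trmx -!map_mxM [RHS]mxE.
  rewrite BE !mulmxA -/y -mulmxA yE mxE.
  apply: eq_bigr => i _; rewrite mul_mx_diag yC.
  by rewrite [X in X * _]mxE mulrA [y 0 i * sp 0 i]mulrC.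
have normE : toC ((x *m x^T) 0 0) = \sum_i (y 0 i * (y 0 i)^*).
  have -> : toC ((x *m x^T) 0 0) = (z *m z^T) 0 0.
    by rewrite /z map_trmx -!map_mxM [RHS]mxE.
  have -> : z *m z^T = y *m (P *m z^T).
    by rewrite /y mulmxA -[z *m invmx P *m P]mulmxA mulVmx // mulmx1.
  by rewrite yE mxE; apply: eq_bigr => i _; rewrite yC.
rewrite -lecR /= rmorphM /= -/toC quadE normE mulr_sumr.
apply: ler_sum => i _; apply: ler_wpM2r; first exact: mul_conjC_ge0.
by rewrite spE /toC lecR; apply: i0_max.
Qed.

(** The Rayleigh bound, evaluated at an eigenvector of [b] and divided by its positive squared norm,
    gives [b <= a]. So a largest eigenvalue exists and the default value of [xget] is not taken. *)
Lemma largest_eigenvalueP (R : realType) (n : nat) (A : 'M[R]_n) :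
  (0 < n)%N -> A^T = A ->
  let a := largest_eigenvalue A in
  [/\ eigenvalue A a, forall b, eigenvalue A b -> b <= a &
    forall x : 'rV[R]_n, (x *m A *m x^T) 0 0 <= a * (x *m x^T) 0 0].
Proof.
move=> n_gt0 symA /=; rewrite /largest_eigenvalue.
have [a aA a_max] := symmetric_max_eigenvalue n_gt0 symA.
have ub b : eigenvalue A b -> b <= a.
  case/eigenvalueP => x xA x_neq0; have := a_max x.
  rewrite xA -scalemxAl [in leLHS]mxE ler_pM2r // mxE.
  under eq_bigr do rewrite mxE -expr2.
  rewrite lt_neqAle sumr_ge0 ?andbT => [|i _]; last exact: sqr_ge0.
  rewrite eq_sym psumr_neq0 => [|i _]; last exact: sqr_ge0.
  case/rV0Pn: x_neq0 => i xi; apply/hasP; exists i; first exact: mem_index_enum.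
  by rewrite /= lt_neqAle sqr_ge0 eq_sym sqrf_eq0 xi.
rewrite (@classical_sets.xget_unique _ _ _ a) // => b [/ub b_le /(_ a aA) a_le].
exact/le_anti/andP.
Qed.

Lemma has_path_of_length_sym (G : sgraph) (x y : G) k :
  has_path_of_length x y k = has_path_of_length y x k.
Proof.
suff half (u v : G) : has_path_of_length u v k -> has_path_of_length v u k.
  by apply/idP/idP; apply: half.
case/existsP => p /and3P[p_path /eqP p_last p_uniq].
have sz : size (rev (belast u p)) == k by rewrite size_rev size_belast size_tuple.
apply/existsP; exists (Tuple sz); apply/and3P; split.
- by rewrite -p_last rev_path (eq_path (e' := @sedge G)) // => a b; apply: sedge_sym.
- by rewrite /= -p_last; case: (tval p) => [|b q] //=; rewrite rev_cons last_rcons.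
- by rewrite -p_last -rev_rcons -lastI rev_uniq.
Qed.

Lemma gdist_sym (G : sgraph) (x y : G) : gdist x y = gdist y x.
Proof. by apply: eq_find => k; apply: has_path_of_length_sym. Qed.

Lemma distance_matrix_sym (R : realType) (G : sgraph) :
  (distance_matrix R G)^T = distance_matrix R G.
Proof. by apply/matrixP => i j; rewrite !mxE gdist_sym. Qed.

(** Reindexing from ordinals to vertices lets test vectors be plain functions on [G]. *)
Lemma distance_rayleigh (R : realType) (G : sgraph) (x : G -> R) :
  (0 < #|G|)%N ->
  \sum_u \sum_v x u * (gdist u v)%:R * x v
    <= largest_eigenvalue (distance_matrix R G) * \sum_u x u ^+ 2.
Proof.
move=> G_gt0; have [_ _] := largest_eigenvalueP G_gt0 (distance_matrix_sym R G).
move/(_ (\row_i x (enum_val i))); congr (_ <= _ * _).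
  rewrite mxE exchange_big (reindex _ (onW_bij _ (@enum_val_bij G))) /=.
  apply: eq_bigr => j _; rewrite !mxE mulr_suml.
  rewrite (reindex _ (onW_bij _ (@enum_val_bij G))) /=.
  by apply: eq_bigr => i _; rewrite !mxE.
rewrite mxE (reindex _ (onW_bij _ (@enum_val_bij G))) /=.
by apply: eq_bigr => i _; rewrite !mxE expr2.
Qed.

(* A positive eigenvector [x] pairs positively with the entrywise absolute value
   of any other eigenvector, which bounds every eigenvalue by that of [x]. *)
Lemma largest_eigenvalue_perron (R : realType) (G : sgraph) (x : G -> R) (rho : R) :
  (0 < #|G|)%N -> (forall u, 0 < x u) ->
  (forall u, \sum_v x v * (gdist v u)%:R = rho * x u) ->
  largest_eigenvalue (distance_matrix R G) <= rho.
Proof.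
move=> G_gt0 x_gt0 xE.
have [/eigenvalueP[y yA /rV0Pn[i0 yi0]] _ _] :=
  largest_eigenvalueP G_gt0 (distance_matrix_sym R G).
set a := largest_eigenvalue _ in yA *.
pose z u := `|y 0 (enum_rank u)|.
have pair_gt0 : 0 < \sum_u x u * z u.
  rewrite (bigD1 (enum_val i0)) //= ltr_pwDl //.
    by rewrite mulr_gt0 // /z enum_valK normr_gt0.
  by apply: sumr_ge0 => u _; rewrite mulr_ge0 ?normr_ge0 // ltW.
rewrite -(ler_pM2r pair_gt0).
(* The triangle inequality for a matrix with nonnegative entries; since [a] is at most its absolute
   value, no sign of [a] is assumed. *)
have zE u : a * z u <= \sum_v z v * (gdist v u)%:R.
  apply: (le_trans (ler_norm _)); rewrite normrM normr_id -normrM.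
  have := congr1 (fun r : 'rV_#|G| => r 0 (enum_rank u)) yA.
  rewrite !mxE => <-.
  apply: (le_trans (ler_norm_sum _ _ _)).
  rewrite [leRHS](reindex _ (onW_bij _ (@enum_val_bij G))) /=.
  apply: ler_sum => i _.
  by rewrite !mxE enum_rankK normrM normr_nat /z enum_valK.
rewrite !mulr_sumr.
apply: (@le_trans _ _ (\sum_u x u * \sum_v z v * (gdist v u)%:R)).
  by apply: ler_sum => u _; rewrite mulrCA ler_wpM2l // ltW.
under eq_bigr do rewrite mulr_sumr.
rewrite exchange_big le_eqVlt; apply/orP; left; apply/eqP/eq_bigr => v _ /=.
rewrite mulrA -xE mulr_suml.
by apply: eq_bigr => u _; rewrite gdist_sym mulrA mulrAC.
Qed.

(** * Distances and the extremal graph *)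

Lemma gdist_le (G : sgraph) (x y : G) k :
  has_path_of_length x y k -> (k < #|G|)%N -> (gdist x y <= k)%N.
Proof.
move=> xy_path k_lt; rewrite leqNgt; apply/negP => /(before_find 0%N).
by rewrite nth_iota // add0n xy_path.
Qed.

(** The bound [k <= #|G|] also covers pairs without a path, whose [gdist] is the default value
    [#|G|]. *)
Lemma gdist_ge (G : sgraph) (x y : G) k :
  (forall j, (j < k)%N -> ~~ has_path_of_length x y j) -> (k <= #|G|)%N ->
  (k <= gdist x y)%N.
Proof.
move=> no_path k_le; rewrite leqNgt; apply/negP => dist_lt.
have dist_ltG : (gdist x y < #|G|)%N by apply: leq_trans k_le.
have /(nth_find 0%N) : has (has_path_of_length x y) (iota 0 #|G|).
  by rewrite has_find size_iota.
by rewrite nth_iota // add0n; apply/negP/no_path.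
Qed.

Lemma has_path_of_length0 (G : sgraph) (x y : G) :
  has_path_of_length x y 0 = (x == y).
Proof.
apply/existsP/idP => [[p]|/eqP->]; first by rewrite (tuple0 p) /= andbT.
by exists [tuple]; rewrite /= eqxx.
Qed.

Lemma has_path_of_length1 (G : sgraph) (x y : G) :
  has_path_of_length x y 1 = sedge x y.
Proof.
apply/existsP/idP => [[p]|xy].
  case: p => [[|z [|? ?]] //= _].
  by rewrite andbT => /and3P[xz /eqP<- _].
exists [tuple y]; rewrite /= xy eqxx inE !andbT /=.
by apply: contraTneq xy => ->; rewrite sedge_irr.
Qed.

Lemma gdist_lower_bound (G : sgraph) (x y : G) : (1 < #|G|)%N ->
  ((x != y) + ((x != y) && ~~ sedge x y) <= gdist x y)%N.
Proof.
move=> G_gt1; case: eqVneq => //= xy; case: (boolP (sedge x y)) => /= [_|nxy].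
  apply: gdist_ge => [[|j] //|]; last exact: ltnW.
  by rewrite has_path_of_length0.
by apply: gdist_ge => // [[|[|j]] // _];
  rewrite ?has_path_of_length0 ?has_path_of_length1.
Qed.

(** A common neighbour gives a path of length 2, so in diameter at most 2 this matches
    [gdist_lower_bound] and determines the distance. *)
Lemma gdist_upper_bound (G : sgraph) (x y : G) : (2 < #|G|)%N ->
  (x != y -> ~~ sedge x y -> exists2 z, sedge x z & sedge z y) ->
  (gdist x y <= (x != y) + ((x != y) && ~~ sedge x y))%N.
Proof.
move=> G_gt2 common.
have neq (a b : G) : sedge a b -> a != b.
  by apply: contraTneq => ->; rewrite sedge_irr.
case: eqVneq common => [->|xy] /= common.
  by apply: gdist_le; rewrite ?has_path_of_length0 //; lia.
case: (boolP (sedge x y)) common => /= [xy_edge _|_ /(_ isT isT)[z xz zy]].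
  by apply: gdist_le; rewrite ?has_path_of_length1 //; lia.
apply: gdist_le => //; apply/existsP; exists [tuple z; y].
by rewrite /= xz zy eqxx !inE negb_or xy !neq.
Qed.

(* The pairs at distance 2 in the join of K_A with the disjoint union of K_B and
   the single vertex v, where B is the complement of A and v. *)
Definition cone_far (V : finType) (A : {set V}) (v x y : V) : bool :=
  ((x == v) && (y != v) && (y \notin A)) || ((y == v) && (x != v) && (x \notin A)).

(** This is the true distance once [A] is nonempty: a vertex of [A] is then a common neighbour of
    every far pair. *)
Definition cone_dist (V : finType) (A : {set V}) (v x y : V) : nat :=
  (x != y) + cone_far A v x y.

Definition cone_weight (R : realType) (V : finType) (A : {set V}) (v : V) (b d : R)
    (x : V) : R :=
  if x == v then d else if x \in A then 1 else b.

Definition cone_graph (G : sgraph) (A : {set G}) (v : G) : Prop :=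
  forall x y, sedge x y = (x != y) && ~~ cone_far A v x y.

Lemma cone_far_neq (V : finType) (A : {set V}) (v x y : V) :
  cone_far A v x y -> x != y.
Proof. by apply: contraTneq => ->; rewrite /cone_far; case: (y == v). Qed.

(** [mu] is the total weight. Distinct vertices contribute [mu - w x] to the sum at [x], and far
    pairs add nothing on [A], [d] on the remaining vertices and [m * b] at [v]. The last two
    equations say that each total is [(mu - 1) * w x]. *)
Lemma cone_dist_eigen (R : realType) (V : finType) (A : {set V}) (v : V)
    (p m : nat) (mu b d : R) :
  v \notin A -> #|A| = p -> #|V| = (p + m).+1 ->
  mu = p%:R + m%:R * b + d -> mu * b = mu + d -> mu * d = mu + m%:R * b ->
  forall x, \sum_y cone_weight A v b d y * (cone_dist A v y x)%:R
    = (mu - 1) * cone_weight A v b d x.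
Proof.
move=> vA cardA cardV muE mubE mudE x; set w := cone_weight A v b d.
have cardB : #|[set y | (y != v) && (y \notin A)]| = m.
  have -> : [set y | (y != v) && (y \notin A)] = ~: (v |: A).
    by apply/setP => y; rewrite !inE negb_or.
  by have := cardsC (v |: A); rewrite cardsU1 vA cardA cardV; lia.
have wB : \sum_(y | (y != v) && (y \notin A)) w y = m%:R * b.
  transitivity (\sum_(y | (y != v) && (y \notin A)) b).
    by apply: eq_bigr => y /andP[/negPf yv /negPf yA]; rewrite /w /cone_weight yv yA.
  rewrite sumr_const mulr_natl; congr (_ *+ _); rewrite -cardB.
  by apply: eq_card => y; rewrite !inE.
have wA : \sum_(y | (y != v) && (y \in A)) w y = p%:R.
  transitivity (\sum_(y in A) (1 : R)).
    apply: eq_big => [y|y /andP[/negPf yv yA]]; last by rewrite /w /cone_weight yv yA.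
    by case: eqVneq => [->|//]; rewrite (negPf vA).
  by rewrite sumr_const cardA.
have wV : \sum_y w y = mu.
  rewrite (bigD1 v) //= (bigID (mem A)) /= wA wB /w /cone_weight eqxx muE.
  ring.
have far_sum : \sum_y w y * (cone_far A v y x)%:R = mu * w x - mu.
  have -> : mu * w x - mu = if x == v then m%:R * b else if x \in A then 0 else d.
    rewrite /w /cone_weight; case: ifP => _; first by rewrite mudE; ring.
    by case: ifP => _; [ring | rewrite mubE; ring].
  case: eqVneq => [->|xv].
    rewrite -wB [RHS]big_mkcond; apply: eq_bigr => y _ /=.
    rewrite /cone_far eqxx /= andbF /=.
    by case: ifP => _; rewrite ?mulr1 ?mulr0.
  case: ifP => xA.
    by apply: big1 => y _; rewrite /cone_far xA (negPf xv) !andbF mulr0.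
  rewrite (bigD1 v) //= big1 => [|y /negPf yv].
    by rewrite /cone_far eqxx xv xA /= mulr1 addr0 /w /cone_weight eqxx.
  by rewrite /cone_far yv (negPf xv) mulr0.
have neq_sum : \sum_y w y * (y != x)%:R = mu - w x.
  rewrite -wV [in RHS](bigD1 x) //= (bigD1 x) //= eqxx mulr0 add0r [RHS]addrAC subrr add0r.
  by apply: eq_bigr => y ->; rewrite mulr1.
under eq_bigr do rewrite natrD mulrDr.
rewrite big_split /= neq_sum far_sum; ring.
Qed.

Lemma cone_parameters (R : realType) (p m : nat) : (0 < m)%N ->
  exists mu b d : R, [/\ mu < (p + m).+1%:R + 3, 0 < b, 0 < d
    & [/\ mu = p%:R + m%:R * b + d, mu * b = mu + d & mu * d = mu + m%:R * b]].
Proof.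
move=> m_gt0; set n := (p + m).+1.
have nE : n%:R = p%:R + m%:R + 1 :> R by rewrite /n -addn1 !natrD.
have p_ge0 : 0 <= p%:R :> R by apply: ler0n.
have m_ge1 : 1 <= m%:R :> R by rewrite ler1n.
(* Eliminating b and d leaves a cubic equation for mu. *)
pose f : {poly R} :=
  'X^3 - n%:R *: 'X^2 - (3 * m%:R) *: 'X + (p%:R * m%:R)%:P.
have fE u : f.[u] = u ^+ 3 - n%:R * u ^+ 2 - 3 * m%:R * u + p%:R * m%:R.
  by rewrite /f !hornerE.
have le_n : n%:R <= n%:R + 3 :> R by lra.
(* The values are [f(n) = - m * (3n - p)], which is negative, and [f(n+3) = 3(n+3)(n+3-m) + p*m],
   which is positive. *)
have f_sign : f.[n%:R] * f.[n%:R + 3] < 0.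
  rewrite nmulr_rlt0 !fE nE; nra.
have [mu] := poly_ivtoo le_n f_sign.
rewrite in_itv /= => /andP[mu_gt mu_lt] /rootP; rewrite fE => f0.
have q_gt0 : 0 < mu ^+ 2 - m%:R by rewrite nE in mu_gt; nra.
have q_neq0 : mu ^+ 2 - m%:R != 0 by rewrite gt_eqF.
have mu_gt0 : 0 < mu by rewrite nE in mu_gt; lra.
(* Cramer's rule for the last two equations, linear in [b] and [d] with determinant [mu ^+ 2 - m].
   The first equation then reduces to [f(mu) = 0]. *)
exists mu, (mu * (mu + 1) / (mu ^+ 2 - m%:R)), (mu * (mu + m%:R) / (mu ^+ 2 - m%:R)).
split => //; try by rewrite divr_gt0 // mulr_gt0 //; lra.
split; [|by field|by field].
apply/eqP; rewrite -subr_eq0 -(mulIr_eq0 _ (mulIf q_neq0)).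
by apply/eqP; rewrite -f0 nE; field.
Qed.

Lemma extremal_graph_cone (t n : nat) : (2 <= t)%N -> (t < n)%N ->
  exists A (v : extremal_graph t n),
    [/\ cone_graph A v, v \notin A, #|A| = t.-1, #|extremal_graph t n| = n
      & forall x y, gdist x y = cone_dist A v x y].
Proof.
move=> t_ge2 t_lt; set H := extremal_graph t n.
pose A : {set H} := [set x : H | if x is inl _ then true else false].
pose v : H := inr (inr ord0).
have cardH : #|H| = n.
  by rewrite /H /= !card_sum !card_ord; lia.
have HE : cone_graph A v.
  have eq_v x : (inr (inr x) == v :> H) = true by rewrite (ord1 x).
  by move=> [x|[x|x]] [y|[y|y]]; rewrite /cone_far !inE //= ?eq_v ?andbF ?andbT //.
exists A; exists v; split; [exact: HE | by rewrite inE | | exact: cardH | move=> x y].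
- have -> : A = inl @: [set: 'I_(t - 1)].
    apply/setP => -[x|x]; rewrite inE; first by rewrite imset_f.
    by apply/esym/negbTE/imsetP => -[].
  by rewrite card_imset ?cardsT ?card_ord; [lia | move=> ? ? []].
have -> : cone_dist A v x y = ((x != y) + ((x != y) && ~~ sedge x y))%N.
  rewrite /cone_dist HE; case: eqVneq => [->|xy] /=; last by rewrite negbK.
  by case: (boolP (cone_far _ _ _ _)) => // /cone_far_neq; rewrite eqxx.
apply/eqP; rewrite eqn_leq gdist_lower_bound ?cardH ?andbT; try lia.
have t1 : (0 < t - 1)%N by lia.
apply: gdist_upper_bound => [|xy nxy]; first by rewrite cardH; lia.
(* A vertex of the clique of order [t - 1], nonempty because [t >= 2], serves as common
   neighbour. *)
by exists (inl (Ordinal t1)); case: x y xy nxy => [x|x] [y|y] //= /[swap] /negPf;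
  rewrite // /complete_edge /= => /negbFE/eqP->; rewrite eqxx.
Qed.

(** * Vertices of low degree *)

Lemma exists_set_between (T : finType) (X Y : {set T}) k :
  X \subset Y -> (#|X| <= k <= #|Y|)%N ->
  exists A : {set T}, [/\ X \subset A, A \subset Y & #|A| = k].
Proof.
move=> XY; elim: k => [|k IHk] /andP[].
  by rewrite leqn0 => /eqP cX _; exists X.
rewrite leq_eqVlt => /predU1P[cX _|]; first by exists X.
rewrite ltnS => leX leY; have [|A [XA AY cA]] := IHk; first by rewrite leX ltnW.
have /properP[_ [y yY yA]] : A \proper Y by rewrite properEcard AY cA.
exists (y |: A); split; last by rewrite cardsU1 yA cA.
  exact/(subset_trans XA)/subsetUr.
by rewrite subUset sub1set yY.
Qed.

Section ConeEnumeration.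
Variables (V : finType) (A : {set V}) (v : V).
Hypothesis vA : v \notin A.

(** With the apex first, then [A], then the rest, the class of a vertex can be read off its
    index. *)
Definition cone_enum := v :: enum A ++ enum (~: (v |: A)).

Lemma cone_enum_uniq : uniq cone_enum.
Proof.
rewrite /= mem_cat !mem_enum !inE eqxx (negPf vA) /= cat_uniq !enum_uniq andbT.
by apply/hasPn => x; rewrite !mem_enum !inE negb_or => /andP[].
Qed.

Lemma mem_cone_enum x : x \in cone_enum.
Proof. by rewrite inE mem_cat !mem_enum !inE; case: (x == v); case: (x \in A). Qed.

Lemma size_cone_enum : size cone_enum = #|V|.
Proof.
by rewrite -(card_uniqP cone_enum_uniq); apply/eq_card => x; rewrite mem_cone_enum.
Qed.

Lemma cone_index_apex x : (x == v) = (index x cone_enum == 0%N).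
Proof. by rewrite /= [v == x]eq_sym; case: eqP. Qed.

Lemma cone_index_base x : (x \in A) = (0 < index x cone_enum <= #|A|)%N.
Proof.
rewrite /= [v == x]eq_sym; case: eqP => [->|_]; first exact/negbTE.
rewrite index_cat mem_enum; case: ifP => xA; rewrite ltnS /=.
  by rewrite cardE index_mem mem_enum xA.
by rewrite -cardE; lia.
Qed.
End ConeEnumeration.

(** Adjacency depends only on equality and on the three classes, so matching positions in the two
    enumerations is an isomorphism. *)
Lemma cone_graph_iso (G H : sgraph) (A : {set G}) (v : G) (B : {set H}) (w : H) :
  cone_graph A v -> cone_graph B w -> v \notin A -> w \notin B ->
  #|A| = #|B| -> #|G| = #|H| -> graph_iso G H.
Proof.
move=> coneA coneB vA wB cardAB cardGH.
pose sG := cone_enum A v; pose sH := cone_enum B w.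
pose f x := nth w sH (index x sG); pose g y := nth v sG (index y sH).
have szGH : size sG = size sH by rewrite !size_cone_enum.
have fI x : index (f x) sH = index x sG.
  by rewrite index_uniq ?cone_enum_uniq // -szGH index_mem mem_cone_enum.
have gI y : index (g y) sG = index y sH.
  by rewrite index_uniq ?cone_enum_uniq // szGH index_mem mem_cone_enum.
have fK : cancel f g by move=> x; rewrite /g fI nth_index ?mem_cone_enum.
have gK : cancel g f by move=> y; rewrite /f gI nth_index ?mem_cone_enum.
have f_apex x : (f x == w) = (x == v) by rewrite !(cone_index_apex A, cone_index_apex B) fI.
have f_base x : (f x \in B) = (x \in A).
  by rewrite (cone_index_base vA) (cone_index_base wB) fI cardAB.
exists f; first by exists g.
by move=> x y; rewrite coneA coneB /cone_far !f_apex !f_base (can_eq fK).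
Qed.

Lemma cone_weight_gt0 (R : realType) (V : finType) (A : {set V}) (v : V) (b d : R) x :
  0 < b -> 0 < d -> 0 < cone_weight A v b d x.
Proof. by move=> b_gt0 d_gt0; rewrite /cone_weight; case: ifP => // _; case: ifP. Qed.

Lemma extremal_largest_eigenvalue_le (R : realType) (t n : nat) (mu b d : R) :
  (2 <= t)%N -> (t < n)%N -> 0 < b -> 0 < d ->
  mu = t.-1%:R + (n - t)%:R * b + d -> mu * b = mu + d -> mu * d = mu + (n - t)%:R * b ->
  largest_eigenvalue (distance_matrix R (extremal_graph t n)) <= mu - 1.
Proof.
move=> t_ge2 t_lt b_gt0 d_gt0 muE mubE mudE.
have [B [w [_ wB cardB cardH distH]]] := extremal_graph_cone t_ge2 t_lt.
apply: (largest_eigenvalue_perron (x := cone_weight B w b d)) => [|u|u].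
- by rewrite cardH; lia.
- exact: cone_weight_gt0.
under eq_bigr do rewrite distH.
by rewrite (cone_dist_eigen wB cardB _ muE) // cardH; lia.
Qed.

Lemma extremal_largest_eigenvalue_lt (R : realType) (t n : nat) :
  (2 <= t)%N -> (t < n)%N ->
  largest_eigenvalue (distance_matrix R (extremal_graph t n)) < n%:R + 2.
Proof.
move=> t_ge2 t_lt; have m_gt0 : (0 < n - t)%N by rewrite subn_gt0.
have [mu [b [d [mu_lt b_gt0 d_gt0 [muE mubE mudE]]]]] := cone_parameters R t.-1 m_gt0.
apply: le_lt_trans (extremal_largest_eigenvalue_le t_ge2 t_lt b_gt0 d_gt0 muE mubE mudE) _.
have nE : n = (t.-1 + (n - t)).+1 by lia.
by rewrite -nE in mu_lt; lra.
Qed.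

Lemma low_degree_extremal (R : realType) (t n : nat) (G : sgraph) (v : G) :
  (2 <= t)%N -> (t < n)%N -> #|G| = n -> (#|[set u | sedge v u]| < t)%N ->
  largest_eigenvalue (distance_matrix R G)
    <= largest_eigenvalue (distance_matrix R (extremal_graph t n)) ->
  graph_iso G (extremal_graph t n).
Proof.
move=> t_ge2 t_lt cardG deg_v hlam.
have [B [w [coneB wB cardB cardH _]]] := extremal_graph_cone t_ge2 t_lt.
have m_gt0 : (0 < n - t)%N by rewrite subn_gt0.
have [mu [b [d [_ b_gt0 d_gt0 [muE mubE mudE]]]]] := cone_parameters R t.-1 m_gt0.
have nE : n = (t.-1 + (n - t)).+1 by lia.
(* The neighbourhood of [v] has at most [t - 1] vertices and is padded to exactly [t - 1]. Every far
   pair for [A] and [v] is then non-adjacent in [G]. *)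
have [A [NA AY cardA]] :
    exists A : {set G},
      [/\ [set u | sedge v u] \subset A, A \subset ~: [set v] & #|A| = t.-1].
  apply: exists_set_between.
    by apply/subsetP => u; rewrite !inE; apply: contraTneq => ->; rewrite sedge_irr.
  by have := cardsC [set v]; rewrite cards1 cardG; lia.
have vA : v \notin A by apply/negP => /(subsetP AY); rewrite !inE eqxx.
have lamH := extremal_largest_eigenvalue_le t_ge2 t_lt b_gt0 d_gt0 muE mubE mudE.
pose x := cone_weight A v b d.
have x_gt0 u : 0 < x u by apply: cone_weight_gt0.
have farN u1 u2 : cone_far A v u1 u2 -> ~~ sedge u1 u2.
  have NvA u : u \notin A -> ~~ sedge v u.
    by apply: contra => vu; apply: (subsetP NA); rewrite inE.
  rewrite /cone_far => /orP[/andP[/andP[/eqP-> _]]|/andP[/andP[/eqP-> _]]].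
    exact: NvA.
  by rewrite sedge_sym; exact: NvA.
have G_gt1 : (1 < #|G|)%N by rewrite cardG; lia.
have dist_ge u1 u2 : (cone_dist A v u1 u2 <= gdist u1 u2)%N.
  apply: leq_trans (gdist_lower_bound u1 u2 G_gt1); rewrite leq_add2l.
  by case: (boolP (cone_far _ _ _ _)) => // far; rewrite (cone_far_neq far) farN.
pose term u1 u2 := x u1 * ((gdist u1 u2)%:R - (cone_dist A v u1 u2)%:R) * x u2.
have term_ge0 u1 u2 : 0 <= term u1 u2.
  by rewrite !mulr_ge0 ?subr_ge0 ?ler_nat // ltW.
(* The cone form at [x] equals [mu - 1] times the squared norm, while the form of [D(G)] is at most
   that by the eigenvalue hypothesis. As each [term] is nonnegative and [x] is positive, all
   distances must agree. *)
have term_sum : \sum_u1 \sum_u2 term u1 u2 <= 0.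
  have coneE : \sum_u1 \sum_u2 x u1 * (cone_dist A v u1 u2)%:R * x u2
      = (mu - 1) * \sum_u x u ^+ 2.
    rewrite exchange_big mulr_sumr; apply: eq_bigr => u _ /=.
    by rewrite -mulr_suml (cone_dist_eigen vA cardA _ muE) ?cardG // mulrA.
  have -> : \sum_u1 \sum_u2 term u1 u2 =
      \sum_u1 \sum_u2 x u1 * (gdist u1 u2)%:R * x u2 - (mu - 1) * \sum_u x u ^+ 2.
    rewrite -coneE -sumrB; apply: eq_bigr => u1 _; rewrite -sumrB.
    by apply: eq_bigr => u2 _; rewrite /term mulrBr mulrBl.
  rewrite subr_le0; apply: (le_trans (distance_rayleigh x (ltnW G_gt1))).
  apply: ler_wpM2r; last exact: le_trans lamH.
  by apply: sumr_ge0 => u _; apply: sqr_ge0.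
have distE u1 u2 : gdist u1 u2 = cone_dist A v u1 u2.
  have sum_ge0 u : 0 <= \sum_u' term u u' by apply: sumr_ge0.
  have sum0 : \sum_u \sum_u' term u u' = 0.
    by apply/eqP; rewrite eq_le term_sum; apply: sumr_ge0.
  have := psumr_eq0P (fun u _ => sum_ge0 u) sum0 (i := u1) isT.
  move/(psumr_eq0P (fun u _ => term_ge0 u1 u))/(_ u2 isT)/eqP.
  rewrite /term !mulf_eq0 !(gt_eqF (x_gt0 _)) /= orbF subr_eq0 eqr_nat.
  by move/eqP.
apply: (cone_graph_iso _ coneB vA wB); rewrite ?cardA ?cardG // => u1 u2.
case: (eqVneq u1 u2) => [->|neq] /=; first by rewrite sedge_irr.
apply/idP/idP => [edge|nfar].
  by apply/negP => /farN; rewrite edge.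
(* The distance here is 1, while a non-adjacent pair would have distance at least 2. *)
have := gdist_lower_bound u1 u2 G_gt1; rewrite distE /cone_dist neq (negPf nfar) /=.
by case: (sedge u1 u2).
Qed.

(** With the all-ones vector and [n = #|G|], each ordered pair of distinct vertices contributes at
    least 1 and each non-adjacent one at least 1 more. The total is at least
    [n(n-1) + 3n = n(n+2)]. *)
Lemma many_far_pairs (R : realType) (G : sgraph) : (1 < #|G|)%N ->
  (3 * #|G| <= \sum_(u : G) \sum_(v : G) ((u != v) && ~~ sedge u v))%N ->
  #|G|%:R + 2 <= largest_eigenvalue (distance_matrix R G).
Proof.
move=> G_gt1 far; have G_gt0 : 0 < #|G|%:R :> R by rewrite ltr0n ltnW.
have := distance_rayleigh (fun _ : G => 1 : R) (ltnW G_gt1).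
under [X in _ <= _ * X]eq_bigr do rewrite expr1n.
rewrite sumr_const => ray; rewrite -(ler_pM2r G_gt0).
apply: le_trans ray.
under eq_bigr => u _ do under eq_bigr => v _ do rewrite mul1r mulr1.
under eq_bigr => u _ do rewrite -natr_sum.
rewrite -natr_sum -natrD -natrM ler_nat.
have neqE (u : G) : (\sum_v (u != v) = #|G|.-1)%N.
  have := cardC1 u; rewrite -sum1_card => <-; rewrite [RHS]big_mkcond /=.
  by apply: eq_bigr => v _; rewrite !inE eq_sym; case: eqP.
have : (\sum_(u : G) #|G|.-1 + 3 * #|G| <= \sum_(u : G) \sum_v gdist u v)%N.
  apply: leq_trans (leq_add (leqnn _) far) _; rewrite -big_split.
  apply: leq_sum => u _ /=; rewrite -(neqE u) -big_split.
  by apply: leq_sum => v _; apply: gdist_lower_bound.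
rewrite sum_nat_const; apply: leq_trans.
by case: (#|G|) G_gt1 => // k _ /=; nia.
Qed.

(** * Components and non-adjacent pairs *)

Section Components.
Variable H : sgraph.
Local Notation r := (fingraph.root (@sedge H)).

Let csym : connect_sym (@sedge H) := sym_connect_sym (@sedge_sym H).

Lemma card_roots : #|[set x : H | r x == x]| = num_components H.
Proof. by rewrite cardsE; apply: eq_card => x; rewrite !inE andbT. Qed.

Lemma root_neq_far (u v : H) : r u != r v -> (u != v) && ~~ sedge u v.
Proof.
move=> ruv; apply/andP; split; first by apply: contraNneq ruv => ->.
by apply: contraNN ruv => uv; rewrite (root_connect csym) connect1.
Qed.

Lemma sum_other_roots z : (\sum_(u | r u == u) (u != r z) = (num_components H).-1)%N.
Proof.
have rz : r z \in [set u : H | r u == u] by rewrite inE (root_root csym).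
rewrite -card_roots (cardsD1 (r z)) rz /= -sum1_card.
rewrite -big_mkcondr /= big_mkcond [RHS]big_mkcond.
by apply: eq_bigr => u _; rewrite !inE andbC; case: eqP; case: eqP.
Qed.

(* Only the pairs containing a component representative are counted; this is
   exact when all components but one are singletons. *)
Lemma separated_pairs_ge :
  ((num_components H).-1 * (2 * #|H| - num_components H)
    <= \sum_(u : H) \sum_(v : H) (r u != r v))%N.
Proof.
rewrite (bigID (fun u => r u == u)) /=.
have rootsE : (\sum_(u | r u == u) \sum_v (r u != r v) = #|H| * (num_components H).-1)%N.
  rewrite exchange_big /= -sum_nat_const; apply: eq_bigr => v _.
  by rewrite -(sum_other_roots v); apply: eq_bigr => u /eqP->.
(* For a non-representative [u], only the representatives [v] of other components are counted,
   [c - 1] of them among [c] components. Together with [rootsE] the factor becomes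
   [#|H| + (#|H| - c)]. *)
have othersE : ((#|H| - num_components H) * (num_components H).-1
    <= \sum_(u | r u != u) \sum_v (r u != r v))%N.
  have -> : (#|H| - num_components H)%N = #|[set u : H | r u != u]|.
    rewrite [RHS]cardsCs -card_roots; congr (_ - _)%N; apply: eq_card => u.
    by rewrite !inE negbK.
  rewrite cardsE -sum_nat_const; apply: leq_sum => u _.
  rewrite -(sum_other_roots u) [leqRHS](bigID (fun v => r v == v)) /=.
  by apply: leq_trans (leq_addr _ _); apply: leq_sum => v /eqP ->; rewrite eq_sym.
rewrite rootsE; apply: leq_trans (leq_add (leqnn _) othersE).
by rewrite -mulnDl mulnC leq_mul2r mul2n -addnn leq_subLR addnCA leq_add2l -leq_subLR
  leqnn orbT.
Qed.

(** One end lies in the component of [x] and the other outside it; the factor 2 accounts for the two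
    orders. *)
Lemma separated_pairs_ge_class x :
  let a := #|[set v | r v == r x]| in
  (2 * (a * (#|H| - a)) <= \sum_(u : H) \sum_(v : H) (r u != r v))%N.
Proof.
set C := [set v | r v == r x]; move=> /=.
have cardC : (#|H| - #|C|)%N = #|~: C| by rewrite [#|~: C|]cardsCs setCK.
rewrite cardC mul2n -addnn (bigID (mem C)) /=; apply: leq_add.
  rewrite -sum_nat_const; apply: leq_sum => u; rewrite inE => /eqP->.
  rewrite -sum1_card [leqLHS]big_mkcond; apply: leq_sum => v _.
  by rewrite !inE [r x == _]eq_sym; case: eqP.
have -> : (#|C| * #|~: C| = \sum_(u | u \notin C) #|C|)%N.
  rewrite sum_nat_const mulnC; congr (_ * _)%N; apply: eq_card => u.
  by rewrite in_setC.
apply: leq_sum => u; rewrite inE => ru.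
rewrite -sum1_card [leqLHS]big_mkcond; apply: leq_sum => v _.
by rewrite !inE; case: eqP => // ->; rewrite ru.
Qed.

Lemma exists_other_root x : (1 < num_components H)%N -> exists y, r y != r x.
Proof.
move=> c_gt1; apply/existsP; rewrite -[[exists _, _]]negbK negb_exists.
apply/negP => /forallP same; move: c_gt1.
rewrite -card_roots ltnNge => /negP[]; rewrite -(cards1 (r x)).
apply/subset_leq_card/subsetP => y; rewrite !inE => /eqP <-.
by have := same y; rewrite negbK.
Qed.
End Components.

Local Notation component := (fingraph.root (@sedge _)).

(** Vertices in different components of [G - S] are distinct and non-adjacent in [G] itself, and
    extending the sums to all of [G] only adds nonnegative terms. *)
Lemma induced_far_pairs (G : sgraph) (S : {set G}) :
  (\sum_(u : induced_graph (~: S)) \sum_(v : induced_graph (~: S))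
      (component u != component v)
    <= \sum_(u : G) \sum_(v : G) ((u != v) && ~~ sedge u v))%N.
Proof.
set H := induced_graph (~: S).
have widen (F : G -> nat) : (\sum_(u : H) F (val u) <= \sum_(u : G) F u)%N.
  rewrite -(big_sub (mem (~: S)) F) [leqRHS](bigID (mem (~: S))) /=.
  exact: leq_addr.
apply: leq_trans (widen _); apply: leq_sum => u _.
apply: leq_trans (widen _); apply: leq_sum => v _.
case: (boolP (component u != _)) => // /root_neq_far.
by rewrite -(inj_eq val_inj) => ->.
Qed.

Lemma card_induced (G : sgraph) (S : {set G}) :
  #|induced_graph (~: S)| = (#|G| - #|S|)%N.
Proof. by rewrite card_sig -[in RHS](setCK S) -cardsCs; apply: eq_card => x. Qed.

(** A neighbour outside [S] would lie in the same component, so all neighbours lie in [S]. *)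
Lemma singleton_component_degree (G : sgraph) (S : {set G}) (x : induced_graph (~: S)) :
  let r := fingraph.root (@sedge (induced_graph (~: S))) in
  (#|[set v | r v == r x]| <= 1)%N -> (#|[set u | sedge (val x) u]| <= #|S|)%N.
Proof.
move=> r comp1; apply/subset_leq_card/subsetP => u; rewrite inE => xu.
apply/negPn/negP => uS; have uSC : u \in ~: S by rewrite inE.
pose y : induced_graph (~: S) := exist _ u uSC.
have ry : r y == r x.
  rewrite /r eq_sym root_connect; last exact/sym_connect_sym/sedge_sym.
  exact: connect1.
have yxE : y = x.
  by move/card_le1_eqP: comp1; apply; rewrite inE // /r.
by move: xu; rewrite -yxE /= sedge_irr.
Qed.

(** * Toughness, counting inequalities and the conclusion *)

Lemma not_tough_cut (t : nat) (G : sgraph) : ~~ is_tough t%:R G ->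
  exists2 S : {set G}, is_cut S & (#|S| < t * (comp_minus S).-1)%N.
Proof.
rewrite /is_tough /toughness; case: pickP => // S0 cutS0.
case: arg_minP => // S cutS _; rewrite -ltNge => ratio_lt; exists S => //.
move: ratio_lt; rewrite /cut_ratio ltr_pdivrMr -?natrM ?ltr_nat //.
by rewrite ltr0n; move: cutS; rewrite /is_cut; lia.
Qed.

(** Here [k + 1] is the number of components and [s] the size of the cut; the right-hand side is the
    bound of [separated_pairs_ge]. *)
Lemma far_pairs_numeric (t n s k : nat) : (2 <= t)%N -> (2 <= k)%N ->
  (4 * t ^ 2 + 5 * t + 1 <= n)%N -> (s < t * k)%N -> (s + k < n)%N ->
  (3 * n <= k * (2 * (n - s) - k.+1))%N.
Proof.
move=> t_ge2 k_ge2 n_ge s_lt sk_lt.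
have [big_k|small_k] := leqP n (k * t.+1).
  (* This rests on the factorisation [4t^2 + 5t + 1 = (4t + 1)(t + 1)]. *)
  have k_ge : (4 * t + 1 <= k)%N by nia.
  (* From [s + k < n] the factor [2(n - s) - (k + 1)] is at least [k + 1 >= 4t + 2 >= 3(t + 1)]. *)
  have : (k * (3 * t.+1) <= k * (2 * (n - s) - k.+1))%N.
    by rewrite leq_mul2l; apply/orP; right; lia.
  by apply: leq_trans; nia.
(* The worst case is [s = t * k - 1]. *)
have : (k * (2 * (n + 1 - t * k) - k.+1) <= k * (2 * (n - s) - k.+1))%N.
  by rewrite leq_mul2l; apply/orP; right; nia.
apply: leq_trans.
have [j jE] : exists j, n = (k * t.+1 + j)%N by exists (n - k * t.+1)%N; lia.
have -> : (2 * (n + 1 - t * k) - k.+1 = 2 * j + k + 1)%N by nia.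
have [i iE] : exists i, k = i.+2 by exists k.-2; lia.
nia.
Qed.

(** With parts of sizes [a, c >= 2], the inequality [(a - 2)(c - 2) >= 0] gives
    [2ac >= 4(n - s) - 8]. This is at least [3n] once [n >= 4s + 8], which follows from [s < t] and
    [n >= 13t + 1]. *)
Lemma two_classes_numeric (t n s a : nat) : (2 <= t)%N ->
  (4 * t ^ 2 + 5 * t + 1 <= n)%N -> (s < t)%N -> (2 <= a)%N -> (a + 2 <= n - s)%N ->
  (3 * n <= 2 * (a * (n - s - a)))%N.
Proof.
move=> t_ge2 n_ge s_lt a_ge2 a_le.
have [c [nE c_ge2]] : exists c, n = (a + c + s)%N /\ (2 <= c)%N.
  by exists (n - s - a)%N; lia.
have -> : (n - s - a = c)%N by lia.
have n_ge13 : (13 * t + 1 <= n)%N by nia.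
have : (2 * (a + c) <= a * c + 4)%N by nia.
lia.
Qed.

Theorem theorem1p2 (R : realType) (t n : nat) (G : sgraph)
    (ht : (2 <= t)%N) (hG : connected_graph G) (hn : #|G| = n)
    (hnt : (4 * t ^ 2 + 5 * t + 1 <= n)%N)
    (hlam : largest_eigenvalue (distance_matrix R G)
            <= largest_eigenvalue (distance_matrix R (extremal_graph t n))) :
  is_tough t%:R G \/ graph_iso G (extremal_graph t n).
Proof.
have t_lt : (t < n)%N by lia.
case: (boolP (is_tough t%:R G)) => [|/not_tough_cut[S cutS S_lt]]; [by left | right].
have [/existsP[v deg_v]|/existsPn deg_ge] :=
  boolP [exists v, #|[set u | @sedge G v u]| < t]%N.
  exact: (low_degree_extremal ht t_lt hn deg_v hlam).
(* So many non-adjacent pairs force the spectral radius up to [n + 2], against the strict bound for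
   the extremal graph. *)
suff far : (3 * #|G| <= \sum_(u : G) \sum_(v : G) ((u != v) && ~~ sedge u v))%N.
  have G_gt1 : (1 < #|G|)%N by lia.
  have := le_lt_trans hlam (extremal_largest_eigenvalue_lt R ht t_lt).
  by rewrite -hn ltNge many_far_pairs.
apply: leq_trans (induced_far_pairs S).
rewrite /is_cut /comp_minus in cutS S_lt.
have := card_induced S; set H := induced_graph (~: S) in cutS S_lt * => cardH.
have c_le : (num_components H <= #|H|)%N by rewrite -card_roots max_card.
have [k_ge2|k_le1] := leqP 2 (num_components H).-1.
  apply: leq_trans (separated_pairs_ge H); rewrite cardH.
  have -> : num_components H = (num_components H).-1.+1 by lia.
  by rewrite /= hn; apply: far_pairs_numeric ht k_ge2 hnt S_lt _; lia.
(* With two components, counting through representatives yields only [2(n - s) - 2] pairs, below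
   [3n]. The product of the component sizes is used instead. *)
have c2 : (num_components H).-1 = 1%N by lia.
rewrite c2 muln1 in S_lt.
(* A one-vertex component would give a vertex of degree at most [#|S| < t], excluded by [deg_ge]. *)
have class_ge2 (x : H) :
    (2 <= #|[set v : H | component v == component x]|)%N.
  rewrite ltnNge; apply/negP => /singleton_component_degree deg_x.
  by have := deg_ge (val x); rewrite (leq_ltn_trans deg_x S_lt).
have /card_gt0P[x _] : (0 < #|H|)%N by lia.
have [y yx] := exists_other_root x cutS.
apply: leq_trans (separated_pairs_ge_class x) => /=.
have := class_ge2 x; have := class_ge2 y.
set a := #|[set v | component v == component x]|.
set b := #|[set v | component v == component y]|.
move=> b_ge2 a_ge2.
have ab_le : (a + b <= #|H|)%N.
  rewrite -cardsUI.
  have -> : [set v : H | component v == component x]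
      :&: [set v : H | component v == component y] = set0.
    by apply/setP => v; rewrite !inE; case: eqP => // ->; rewrite eq_sym (negPf yx).
  by rewrite cards0 addn0 max_card.
move: ab_le; rewrite cardH hn => ab_le.
by apply: two_classes_numeric ht hnt S_lt a_ge2 _; lia.
Qed.
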